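(* Let $\mathcal{H}$ be an inner product space of dimension at least $2$. Let $n\ge 2$, let $x_1,\dots,x_n\in\mathcal{H}$, and let $a_1,\dots,a_n$ be real numbers. If there are indices $i\neq j$ such that $a_i=a_j=-\tfrac12$, then $$\sum_{k=1}^{n}\ \sum_{1\le i_1<i_2<\cdots<i_k\le n} a_{i_1}a_{i_2}\cdots a_{i_k}\sum_{\epsilon_1,\dots,\epsilon_k\in\{1,-1\}}\|\epsilon_1x_{i_1}+\epsilon_2x_{i_2}+\cdots+\epsilon_kx_{i_k}\|^2=0.$$
   Context: The norm is the one induced by the inner product. The innermost sum is over all $2^k$ choices of signs. *)

(* Defs.v *)
From HB Require Import structures.
From mathcomp Require Import all_boot all_order all_algebra.
From mathcomp Require Import sesquilinear.
From mathcomp Require Import reals.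
From mathcomp Require Import complex.

Set Implicit Arguments.
Unset Strict Implicit.
Unset Printing Implicit Defensive.

Import Order.TTheory GRing.Theory Num.Theory.

Local Open Scope ring_scope.

(* Inner product spaces are taken over the reals or over the complex numbers:
   [V : lmodType (scalars R s)], of any dimension, with an inner product
   [dot : {dot V for @scalar_conj R s}], linear in its first argument. *)
Variant scalar_kind := RealScalars | ComplexScalars.

Definition scalars (R : realType) (s : scalar_kind) : numFieldType :=
  match s with
  | RealScalars => R
  | ComplexScalars => R[i]%C
  end.

Definition scalar_conj (R : realType) (s : scalar_kind) :
    scalars R s -> scalars R s :=
  match s with
  | RealScalars => idfun
  | ComplexScalars => Num.conj
  end.

Definition scalar_Re (R : realType) (s : scalar_kind) : scalars R s -> R :=
  match s with
  | RealScalars => idfun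
  | ComplexScalars => @complex.Re R
  end.

(* [dot u u] is a nonnegative real, so [scalar_Re] only changes its type. *)
Definition dot_norm (R : realType) (s : scalar_kind)
    (V : lmodType (scalars R s)) (dot : {dot V for @scalar_conj R s}) (u : V) :
    R :=
  Num.sqrt (scalar_Re (dot u u)).

Definition lin_indep (K : fieldType) (V : lmodType K) (m : nat)
    (e : 'I_m -> V) : Prop :=
  forall c : 'I_m -> K, \sum_(i < m) c i *: e i = 0 -> forall i, c i = 0.

(* [V] may be infinite-dimensional. *)
Definition dim_at_least (K : fieldType) (V : lmodType K) (m : nat) : Prop :=
  exists e : 'I_m -> V, lin_indep e.

(* Main.v *)
Require Import Defs.
From HB Require Import structures.
From mathcomp Require Import all_boot all_order all_algebra.
From mathcomp Require Import sesquilinear.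
From mathcomp Require Import reals.
From mathcomp Require Import complex.

Set Implicit Arguments.
Unset Strict Implicit.
Unset Printing Implicit Defensive.

Import Order.TTheory GRing.Theory Num.Theory.

Local Open Scope ring_scope.

(** Averaging over all signs kills the cross terms of a squared norm, so the sum
over [eps] equals [2 ^ k] times the sum of the squared norms of the [k] chosen
vectors ([sum_signs_bilinear], [sum_signs_dot_norm]). Each of the [k] factors 2
is absorbed by one coefficient, and with [b i = 2 * a i] the left-hand side
becomes the sum over all subsets [A] of the indices of
[(\prod_(i in A) b i) * \sum_(i in A) N i], where [N i] is the squared norm of
[x i]; the increasing tuples are just the subsets listed in order
([sum_sorted_tuples]).

Now collect the coefficient of each [N i]: it is the sum of the products of [b]
over the subsets containing [i], which factors as
[b i * \prod_(m | m != i) (1 + b m)]. Since [b] takes the value [-1] at two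
distinct indices, one of them differs from [i], and the coefficient vanishes
([sum_subsets_eq0]). *)

Section SignSums.

Variables (K : nzRingType) (U : lmodType K) (W : zmodType).
Variables (s s' : K -> W -> W).

(** Flipping the sign at [l] permutes the choices of signs and negates the
summand. Each choice is paired with its flip, as a sum equal to its own opposite
need not vanish in an arbitrary group. *)
Lemma sum_signs_cross (I : finType) (l m : I) (w : W) : l != m ->
  \sum_(eps : {ffun I -> bool})
    (if eps l (+) eps m then - w else w) = 0.
Proof.
move=> neq_lm.
pose flip (eps : {ffun I -> bool}) := [ffun i => (i == l) (+) eps i].
have flipK : involutive flip.
  by move=> eps; apply/ffunP=> i; rewrite !ffunE addbA addbb.
rewrite (bigID (fun eps : {ffun I -> bool} => eps l)) /=.
rewrite [X in _ + X](reindex_inj (inv_inj flipK)) /=.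
under [X in _ + X]eq_bigl do rewrite ffunE eqxx /= negbK.
rewrite -big_split big1 // => eps eps_l.
rewrite /= !ffunE eqxx [m == l]eq_sym (negPf neq_lm) eps_l /=.
by case: (eps m); rewrite /= ?subrr ?addNr.
Qed.

(** The parallelogram law for any number of vectors: in the expansion the
diagonal terms do not depend on the signs, and the others average to 0. *)
Lemma sum_signs_bilinear (f : {bilinear U -> U -> W | s & s'})
    (I : finType) (y : I -> U) :
  \sum_(eps : {ffun I -> bool})
    f (\sum_l (-1) ^+ eps l *: y l) (\sum_l (-1) ^+ eps l *: y l)
  = (\sum_l f (y l) (y l)) *+ 2 ^ #|I|.
Proof.
transitivity (\sum_(eps : {ffun I -> bool}) \sum_l \sum_m
    if eps l (+) eps m then - f (y l) (y m) else f (y l) (y m)).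
  apply: eq_bigr => eps _; rewrite linear_sumlz; apply: eq_bigr => l _.
  rewrite linear_sumr; apply: eq_bigr => m _.
  case: (eps l); case: (eps m);
    by rewrite ?expr0 ?expr1 ?scale1r ?scaleN1r ?linearNl ?linearNr ?opprK.
rewrite exchange_big -sumrMnl; apply: eq_bigr => l _.
rewrite exchange_big (bigD1 l) //= [X in _ + X]big1 ?addr0 => [|m neq_ml].
  under eq_bigr do rewrite addbb.
  by rewrite sumr_const card_ffun card_bool.
by rewrite sum_signs_cross // eq_sym.
Qed.

End SignSums.

Section DotNorm.

Variables (R : realType) (s : scalar_kind) (V : lmodType (scalars R s)).
Variable dot : {dot V for @scalar_conj R s}.

Lemma scalar_ReD : {morph @scalar_Re R s : z w / z + w}.
Proof. by case: s => //= -[? ?] [? ?]. Qed.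

Lemma scalar_Re0 : @scalar_Re R s 0 = 0.
Proof. by case: s. Qed.

Lemma scalar_Re_ge0 (z : scalars R s) : 0 <= z -> 0 <= scalar_Re z.
Proof. by case: s z => //= -[p q]; rewrite lecE /= => /andP[]. Qed.

Lemma sqr_dot_norm u : dot_norm dot u ^+ 2 = scalar_Re (dot u u).
Proof.
rewrite sqr_sqrtr // scalar_Re_ge0 //.
have [->|u_neq0] := eqVneq u 0; first by rewrite linear0r.
exact/ltW/neq0_dnorm_gt0.
Qed.

Lemma sum_signs_dot_norm k (y : 'I_k -> V) :
  \sum_(eps : {ffun 'I_k -> bool})
    dot_norm dot (\sum_(l < k) (-1) ^+ eps l *: y l) ^+ 2
  = 2 ^+ k * \sum_(l < k) dot_norm dot (y l) ^+ 2.
Proof.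
under eq_bigr do rewrite sqr_dot_norm.
under [in RHS]eq_bigr do rewrite sqr_dot_norm.
have ReS := big_morph _ scalar_ReD scalar_Re0.
have ReMn z m : scalar_Re (z *+ m) = (@scalar_Re R s z) *+ m.
  by elim: m => [|m IHm]; rewrite ?mulr0n ?scalar_Re0 // !mulrS scalar_ReD IHm.
rewrite -!ReS sum_signs_bilinear card_ord ReMn.
by rewrite -natrX mulr_natl.
Qed.

End DotNorm.

Lemma sorted_enum_ord n (A : {set 'I_n}) : sorted ltn [seq val i | i <- enum A].
Proof.
rewrite -[enum _](eq_filter (mem_enum _)).
rewrite -(eq_filter (mem_map val_inj _)) -filter_map.
by rewrite (sorted_filter ltn_trans) // unlock val_ord_enum iota_ltn_sorted.
Qed.

Lemma enum_sorted_tuple n k (t : k.-tuple 'I_n) :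
  sorted ltn [seq val i | i <- t] -> enum [set i in t] = t.
Proof.
move=> t_sorted; apply: (inj_map val_inj).
apply: (irr_sorted_eq ltn_trans ltnn) (sorted_enum_ord _) t_sorted _ => y.
by apply/mapP/mapP=> [] [i t_i ->]; exists i; rewrite // mem_enum inE in t_i *.
Qed.

Lemma sum_sorted_tuples (W : nmodType) n k (F : {set 'I_n} -> W) :
  \sum_(t : k.-tuple 'I_n | sorted ltn [seq val i | i <- t]) F [set i in t]
  = \sum_(A : {set 'I_n} | #|A| == k) F A.
Proof.
rewrite [RHS](reindex_omap (fun t : k.-tuple 'I_n => [set i in t])
  (fun A => insub (enum A))) => [|A /eqP cardA]; last first.
  rewrite insubT ?cardE ?cardA // => [|sz]; first by rewrite -cardE cardA.
  by congr Some; apply/setP=> i; rewrite inE mem_enum.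
apply: eq_bigl => t; apply/idP/andP => [t_sorted | [_ /eqP]].
  have tE := enum_sorted_tuple t_sorted.
  by rewrite cardE tE size_tuple valK.
by case: insubP => // u _ uE [<-]; rewrite uE sorted_enum_ord.
Qed.

(** The right-hand side expands into one term per set of factors where [b] is
chosen; the second summand is [0] at [i], which forces the choice of [b i], and
[1] elsewhere. *)
Lemma sum_prod_subsets_mem (K : comNzRingType) (I : finType) (b : I -> K)
    (i : I) :
  \sum_(A : {set I} | i \in A) \prod_(m in A) b m
  = \prod_m (b m + (m != i)%:R).
Proof.
rewrite bigA_distr [RHS](bigID (fun A : {set I} => i \in A)) /=.
rewrite [X in _ = _ + X]big1 ?addr0 => [|A iNA]; last first.
  by rewrite (bigD1 i) //= (negPf iNA) eqxx mul0r.
apply: eq_bigr => A iA; rewrite big_mkcond; apply: eq_bigr => m _.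
by case: ifP => // mNA; case: eqP mNA iA => // -> ->.
Qed.

Lemma sum_subsets_eq0 (K : comNzRingType) (I : finType) (b N : I -> K)
    (i j : I) : i != j -> b i = -1 -> b j = -1 ->
  \sum_(A : {set I}) (\prod_(m in A) b m) * (\sum_(m in A) N m) = 0.
Proof.
move=> neq_ij bi bj.
under eq_bigr do rewrite mulr_sumr.
rewrite (exchange_big_dep predT) //= big1 // => m _.
rewrite -mulr_suml sum_prod_subsets_mem.
have [p neq_pm bp] : exists2 p, p != m & b p = -1.
  by have [<-|] := eqVneq i m; [exists j; rewrite // eq_sym | exists i].
by rewrite (bigD1 p) //= bp neq_pm addNr !mul0r.
Qed.

Theorem corollary3p5 (R : realType) (s : scalar_kind)
    (V : lmodType (scalars R s)) (dot : {dot V for @scalar_conj R s})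
    (dimV : dim_at_least V 2) (n : nat) (hn : (2 <= n)%N)
    (x : 'I_n -> V) (a : 'I_n -> R)
    (ha : exists i j : 'I_n, [/\ i != j, a i = - (1 / 2) & a j = - (1 / 2)]) :
  \sum_(1 <= k < n.+1)
    \sum_(t : k.-tuple 'I_n | sorted ltn [seq val i | i <- t])
      (\prod_(l < k) a (tnth t l)) *
      \sum_(eps : {ffun 'I_k -> bool})
        dot_norm dot (\sum_(l < k) (-1) ^+ eps l *: x (tnth t l)) ^+ 2 = 0.
Proof.
have [i [j [neq_ij ai aj]]] := ha.
pose N m := dot_norm dot (x m) ^+ 2; pose b m := 2 * a m.
pose F (A : {set 'I_n}) := (\prod_(m in A) b m) * (\sum_(m in A) N m).
have b_eqN1 m : a m = - (1 / 2) -> b m = -1.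
  by rewrite /b => ->; rewrite mulrN mul1r divff // pnatr_eq0.
transitivity (\sum_(1 <= k < n.+1) \sum_(A : {set 'I_n} | #|A| == k) F A).
  apply: eq_bigr => k _; rewrite -sum_sorted_tuples.
  apply: eq_bigr => t t_sorted.
  rewrite sum_signs_dot_norm mulrA [_ * 2 ^+ k]mulrC.
  rewrite /F -[X in _ = X * _]big_enum -[X in _ = _ * X]big_enum.
  rewrite /= enum_sorted_tuple //.
  rewrite !big_tuple; congr (_ * _).
  by rewrite big_split /= prodr_const card_ord.
(* The empty set contributes an empty sum of norms, so [k = 0] may be included
   and [k] then ranges over all possible cardinals. *)
have F0 : F set0 = 0 by rewrite /F [X in _ * X]big_set0 mulr0.
transitivity (\sum_(0 <= k < n.+1) \sum_(A : {set 'I_n} | #|A| == k) F A).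
  rewrite [RHS]big_nat_recl // big_add1 /= (big_pred1 set0) ?F0 ?add0r // => A.
  exact: cards_eq0.
rewrite big_mkord.
rewrite -[RHS](sum_subsets_eq0 N neq_ij (b_eqN1 i ai) (b_eqN1 j aj)).
rewrite [RHS](partition_big (fun A : {set 'I_n} => inord #|A| : 'I_n.+1)
  predT) //=.
apply: eq_bigr => k _; apply: eq_bigl => A.
by rewrite -val_eqE /= inordK // ltnS -[n in (_ <= n)%N]card_ord max_card.
Qed.
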